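(* There exists an integer $N$ such that for every set $P$ of $n\geq N$ points in general position in the plane, $\binom{n}{2}-5\leq \mu(D(P))\leq \binom{n}{2}-4$.
   Context: A set of points in the plane is in general position if no three of its points are collinear. The disjointness graph of segments $D(P)$ is the graph whose vertices are all closed straight-line segments with both endpoints in $P$, two being adjacent if and only if they are disjoint. For a graph $G$ and $U\subseteq V(G)$, two distinct vertices $x,y\in U$ are $U$-mutually visible if $G$ contains a shortest $x$-$y$ path none of whose internal vertices lies in $U$; $U$ is a mutual-visibility set if every two distinct vertices of $U$ are $U$-mutually visible. The mutual-visibility number $\mu(G)$ is the maximum size of a mutual-visibility set of $G$. *)

(* Defs.v *)
From Stdlib Require Import Reals.
From mathcomp Require Import all_boot.
From mathcomp Require Import boolp.

Set Implicit Arguments.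
Unset Strict Implicit.
Unset Printing Implicit Defensive.

Definition point := (R * R)%type.

Definition collinear (a b c : point) : Prop :=
  Rminus (Rmult (Rminus b.1 a.1) (Rminus c.2 a.2))
         (Rmult (Rminus b.2 a.2) (Rminus c.1 a.1)) = R0.

Definition on_segment (a b z : point) : Prop :=
  exists t : R, Rle R0 t /\ Rle t R1 /\
    z = (Rplus a.1 (Rmult t (Rminus b.1 a.1)),
         Rplus a.2 (Rmult t (Rminus b.2 a.2))).

Definition segments_disjoint (a b c d : point) : Prop :=
  ~ exists z : point, on_segment a b z /\ on_segment c d z.

(* A point set of n points, indexed by 'I_n through an injective map p. *)
Definition general_position n (p : 'I_n -> point) : Prop :=
  forall i j k : 'I_n, i != j -> j != k -> i != k ->
    ~ collinear (p i) (p j) (p k).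

Definition seg_vertex n := {S : {set 'I_n} | #|S| == 2}.

Definition seg_of n (p : 'I_n -> point) (S : seg_vertex n) (z : point) : Prop :=
  exists i j : 'I_n, i \in val S /\ j \in val S /\ i != j /\ on_segment (p i) (p j) z.

Definition disjointness_graph n (p : 'I_n -> point) (s t : seg_vertex n) : Prop :=
  ~ exists z : point, seg_of p s z /\ seg_of p t z.

Section Graph.
Variables (V : finType) (e : V -> V -> Prop).

Fixpoint is_walk (x : V) (s : seq V) : Prop :=
  match s with
  | [::] => True
  | y :: s' => e x y /\ is_walk y s'
  end.

Definition shortest_walk (x y : V) (s : seq V) : Prop :=
  is_walk x s /\ last x s = y /\
  forall t : seq V, is_walk x t -> last x t = y -> size s <= size t.

(* x, y are U-mutually visible: some shortest x-y path has no internal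
   vertex in U; the internal vertices of x :: s are behead (belast x s) *)
Definition mutually_visible (U : {set V}) (x y : V) : Prop :=
  exists s : seq V, shortest_walk x y s /\
    forall v, v \in behead (belast x s) -> v \notin U.

Definition mutual_visibility_set (U : {set V}) : Prop :=
  forall x y, x \in U -> y \in U -> x != y -> mutually_visible U x y.

Definition mu : nat :=
  \max_(U : {set V} | `[< mutual_visibility_set U >]) #|U|.

End Graph.

(* Main.v *)
Require Import Defs.
From Stdlib Require Import Reals.
From mathcomp Require Import all_boot.
From mathcomp Require Import boolp.
From Stdlib Require Import Lra.

(** By Ramsey's theorem for triples, coloured by orientation, a large point set
in general position contains ten points all of whose increasing triples have the
same orientation.  Joining consecutive ones gives five segments; by
multi-affinity of the orientation, points taken on three different ones of them
are never collinear.  So a segment meets at most two of the five, and any two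
segments have a common neighbour among the five.  Hence the diameter is at most
2, and the complement of the five segments is a mutual-visibility set.

Conversely, for any three segments there are two further segments with a common
endpoint whose three endpoints hit all three; these two are not mutually visible
when only the three given segments are available as internal vertices. *)

Set Implicit Arguments.
Unset Strict Implicit.
Unset Printing Implicit Defensive.

(** * Ramsey's theorem for subsequences *)

Section Homogeneous.
Variable T : eqType.
Implicit Types (c : seq T -> bool) (s t : seq T).

Definition homogeneous k c b s :=
  forall t, subseq t s -> size t = k -> c t = b.

(** The colour of a subsequence of length [k.+1] is determined by the position of its first
    entry. *)
Fixpoint prehomogeneous k c s : Prop :=
  if s is x :: s' then
    (exists b, homogeneous k (fun t => c (x :: t)) b s') /\
    prehomogeneous k c s'
  else True.

Lemma homogeneous_subseq k c b s t :
  subseq t s -> homogeneous k c b s -> homogeneous k c b t.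
Proof. by move=> ts hs u ut; apply: hs; apply: subseq_trans ts. Qed.

Lemma homogeneous_cons k c b x s :
  homogeneous k (fun t => c (x :: t)) b s -> homogeneous k.+1 c b s ->
  homogeneous k.+1 c b (x :: s).
Proof.
move=> hx hs [|y t] //=; case: eqP => [-> ts [st]|_ ts st]; first exact: hx.
exact: hs.
Qed.

(** Each entry comes with a colour for the subsequences starting at it; [t b] collects the entries
    of colour [b]. *)
Lemma prehomogeneous_split k c s : prehomogeneous k c s ->
  exists t : bool -> seq T,
    [/\ forall b, subseq (t b) s, forall b, homogeneous k.+1 c b (t b)
      & size (t true) + size (t false) = size s].
Proof.
elim: s => [_|x s IH /= [[b hb] /IH [t [ts ht st]]]].
  by exists (fun=> [::]); split=> // b [].
exists (fun b' => if b' == b then x :: t b' else t b'); split.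
- move=> b'; case: eqP => _; first by rewrite /= eqxx.
  exact: subseq_trans (ts b') (subseq_cons _ _).
- move=> b'; case: eqP => [->|_]; last exact: ht.
  by apply: homogeneous_cons (ht b); apply: homogeneous_subseq hb.
- by case: b {hb} => /=; rewrite -st ?addSn ?addnS.
Qed.

End Homogeneous.

(** Induction on [k]: fixing the first entry [x] gives the colouring [fun t => c (x :: t)] of
    subsequences shorter by one. As [N] is chosen before [c], the induction hypothesis serves all
    these colourings. *)
Lemma ramsey k m : exists N, forall (T : eqType) (c : seq T -> bool) s,
  N <= size s ->
  exists t b, [/\ subseq t s, m <= size t & homogeneous k c b t].
Proof.
elim: k m => [|k IH] m.
  exists m => T c s ms; exists s, (c [::]); split=> //.
  by move=> t _ /size0nil ->.
have [N HN] : exists N, forall (T : eqType) (c : seq T -> bool) s, N <= size s ->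
    exists t, [/\ subseq t s, m + m <= size t & prehomogeneous k c t].
  (* Greedy choice: keep the head, pass to a subsequence of the tail that is homogeneous for it, and
     repeat. Among [m + m] entries, [m] share a colour. *)
  elim: (m + m) => [|j [N HN]].
    by exists 0 => T c s _; exists [::]; rewrite sub0seq.
  have [N' HN'] := IH N.
  exists N'.+1 => T c [//|x s] /= /(HN' T (fun t => c (x :: t))) [t [b [ts Nt ht]]].
  have [u [ut ju hu]] := HN T c t Nt.
  exists (x :: u); split=> //=; first by rewrite eqxx (subseq_trans ut).
  by split=> //; exists b; apply: homogeneous_subseq ht.
exists N => T c s /(HN T c) [u [us mu /prehomogeneous_split [t [tu ht st]]]].
have [b mb] : exists b, m <= size (t b).
  have [|lt1] := leqP m (size (t true)); first by exists true.
  exists false; rewrite leqNgt; apply/negP => lt2.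
  by have := leq_trans mu (eq_leq (esym st)); rewrite leqNgt -addSn leq_add // ltnW.
by exists (t b), b; split=> //; apply: subseq_trans us.
Qed.

(** * Orientation of triples of points *)

Section Orientation.
Local Open Scope R_scope.

Definition orient (a b c : point) : R :=
  (b.1 - a.1) * (c.2 - a.2) - (b.2 - a.2) * (c.1 - a.1).

Definition oriented (s : R) a b c : Prop := 0 < s * orient a b c.

Lemma oriented_rot s a b c : oriented s a b c = oriented s b c a.
Proof. by rewrite /oriented /orient; congr (0 < _); ring. Qed.

(** Orientation is affine in its first argument, so its value at [z] is a convex combination of the
    values at [a] and [b]. *)
Lemma oriented_on_segment s a b z c d : on_segment a b z ->
  oriented s a c d -> oriented s b c d -> oriented s z c d.
Proof.
rewrite /oriented => -[t [t0 [t1 ->]]] ha hb.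
have -> : s * orient (a.1 + t * (b.1 - a.1), a.2 + t * (b.2 - a.2)) c d =
    (1 - t) * (s * orient a c d) + t * (s * orient b c d).
  by rewrite /orient /=; ring.
by have [?|?] := Rlt_le_dec t 1; nra.
Qed.

Lemma on_segment_sym a b z : on_segment a b z -> on_segment b a z.
Proof.
move=> [t [t0 [t1 ->]]]; exists (1 - t); split; first lra.
by split; [lra | congr pair; ring].
Qed.

Lemma on_segment_left a b : on_segment a b a.
Proof.
exists 0; split; [lra | split; [lra |]].
by rewrite [LHS]surjective_pairing; congr pair; ring.
Qed.

Lemma orient_segment a b z1 z2 z3 :
  on_segment a b z1 -> on_segment a b z2 -> on_segment a b z3 ->
  orient z1 z2 z3 = 0.
Proof.
by move=> [? [_ [_ ->]]] [? [_ [_ ->]]] [? [_ [_ ->]]]; rewrite /orient /=; ring.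
Qed.

End Orientation.

(** * Segments and their transversals *)

Section Segments.
Variables (n : nat) (p : 'I_n -> point).
Implicit Types (S A B C x y : seg_vertex n) (i j : 'I_n).

Lemma seg_neq_mem S i : i \in val S -> exists2 j, j \in val S & j != i.
Proof.
move=> iS; have := valP S; rewrite (cardsD1 i) iS add1n eqSS => /eqP s1.
have /set0Pn[j] : val S :\ i != set0 by rewrite -card_gt0 s1.
by rewrite !inE => /andP[ji jS]; exists j.
Qed.

Lemma seg_endpoints S : exists i j, val S = [set i; j].
Proof. by have /cards2P[i [j [_ ->]]] := valP S; exists i, j. Qed.

Lemma seg_ofE S i j z : val S = [set i; j] ->
  seg_of p S z -> on_segment (p i) (p j) z.
Proof.
move=> Sij [k [l [+ [+ []]]]]; rewrite Sij !inE.
case/orP=> /eqP-> /orP[] /eqP-> //; rewrite ?eqxx // => _.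
exact: on_segment_sym.
Qed.

Lemma seg_of_endpoint S i : i \in val S -> seg_of p S (p i).
Proof.
move=> iS; have [j jS ji] := seg_neq_mem iS.
by exists i, j; rewrite eq_sym; do !split=> //; apply: on_segment_left.
Qed.

Lemma oriented_seg_of s S z c d : seg_of p S z ->
  (forall i, i \in val S -> oriented s (p i) c d) ->
  oriented s z c d.
Proof.
by move=> [i [j [iS [jS [_ zij]]]]] h; apply: (oriented_on_segment zij); apply: h.
Qed.

(** Cyclic rotation preserves orientation, so each argument in turn comes first, where affinity
    reduces it to endpoints. *)
Lemma oriented_transversal s A B C a b c :
  seg_of p A a -> seg_of p B b -> seg_of p C c ->
  (forall i j k, i \in val A -> j \in val B -> k \in val C ->
     oriented s (p i) (p j) (p k)) ->
  oriented s a b c.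
Proof.
move=> Aa Bb Cc h.
apply: (oriented_seg_of Aa) => i iA; rewrite oriented_rot.
apply: (oriented_seg_of Bb) => j jB; rewrite oriented_rot.
apply: (oriented_seg_of Cc) => k kC; rewrite oriented_rot.
exact: h.
Qed.

Lemma orient_seg_of3 S a b c :
  seg_of p S a -> seg_of p S b -> seg_of p S c -> orient a b c = R0.
Proof.
have [i [j Sij]] := seg_endpoints S.
by do 3!move=> /(seg_ofE Sij) ?; apply: (@orient_segment (p i) (p j)).
Qed.

Lemma disjointness_graph_sym x y :
  disjointness_graph p x y -> disjointness_graph p y x.
Proof. by move=> h [z [zy zx]]; apply: h; exists z. Qed.

Lemma common_endpoint_not_adjacent x y i :
  i \in val x -> i \in val y -> ~ disjointness_graph p x y.
Proof. by move=> ix iy; apply; exists (p i); split; apply: seg_of_endpoint. Qed.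

Lemma seg_vertex_pair i j : i != j -> {x : seg_vertex n | val x = [set i; j]}.
Proof.
move=> ij; have h : #|[set i; j]| == 2 by rewrite cards2 ij.
by exists (Sub [set i; j] h); rewrite SubK.
Qed.

(** Points of [x] on three different [w a] would have orientation zero, lying on [x], and nonzero,
    being a transversal. *)
Lemma seg_meets_at_most_two m (w : 'I_m -> seg_vertex n) s x :
  (forall (a b c : 'I_m) i j k, a < b < c ->
     i \in val (w a) -> j \in val (w b) -> k \in val (w c) ->
     oriented s (p i) (p j) (p k)) ->
  #|[set a | ~~ `[< disjointness_graph p x (w a) >]]| <= 2.
Proof.
move=> hw; rewrite leqNgt; apply/negP => /card_gt2P[a [b [c [[]]]]].
have meetP d : d \in [set a | ~~ `[< disjointness_graph p x (w a) >]] ->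
    exists z, seg_of p x z /\ seg_of p (w d) z.
  by rewrite inE => /asboolPn; apply: contrapT.
move=> /meetP[za [xa wa]] /meetP[zb [xb wb]] /meetP[zc [xc wc]].
have key (a' b' c' : 'I_m) z1 z2 z3 : a' < b' < c' ->
    seg_of p x z1 -> seg_of p x z2 -> seg_of p x z3 ->
    seg_of p (w a') z1 -> seg_of p (w b') z2 -> seg_of p (w c') z3 -> False.
  move=> abc x1 x2 x3 w1 w2 w3.
  have := @oriented_transversal s _ _ _ _ _ _ w1 w2 w3
            (fun i j k => hw _ _ _ i j k abc).
  rewrite /oriented (orient_seg_of3 x1 x2 x3); lra.
move=> [ab bc ca].
have neq_ltn_ord (i j : 'I_m) : i != j -> (i < j) || (j < i).
  by rewrite -neq_ltn.
(* Six of the eight sign patterns are linear orders of the three indices; the other two are cyclic,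
   hence absurd. *)
case/orP: (neq_ltn_ord _ _ ab) => lt_ab; case/orP: (neq_ltn_ord _ _ bc) => lt_bc;
  case/orP: (neq_ltn_ord _ _ ca) => lt_ca.
- by have := ltn_trans (ltn_trans lt_ab lt_bc) lt_ca; rewrite ltnn.
- by apply: (key a b c za zb zc); rewrite ?lt_ab.
- by apply: (key c a b zc za zb); rewrite ?lt_ca.
- by apply: (key a c b za zc zb); rewrite ?lt_ca.
- by apply: (key b c a zb zc za); rewrite ?lt_bc.
- by apply: (key b a c zb za zc); rewrite ?lt_ab.
- by apply: (key c b a zc zb za); rewrite ?lt_bc.
- by have := ltn_trans (ltn_trans lt_ca lt_bc) lt_ab; rewrite ltnn.
Qed.

End Segments.

(** * Five segments providing common neighbours *)

Lemma subseq_nth3 (T : eqType) (x0 : T) (s : seq T) u v r :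
  u < v < r -> r < size s -> subseq [:: nth x0 s u; nth x0 s v; nth x0 s r] s.
Proof.
move=> /andP[uv vr] rs; rewrite -[X in subseq _ X](mkseq_nth x0).
apply: (@map_subseq _ _ (nth x0 s) [:: u; v; r]).
rewrite -[X in subseq X _](_ : filter [in [:: u; v; r]] (iota 0 (size s)) = _).
  exact: filter_subseq.
apply: (irr_sorted_eq ltn_trans ltnn).
- by rewrite sorted_filter ?iota_ltn_sorted //; apply: ltn_trans.
- by rewrite /= uv vr.
move=> i; rewrite mem_filter mem_iota add0n /= andb_idr // !inE.
have vs := ltn_trans vr rs.
by case/or3P=> /eqP->//; apply: ltn_trans vs.
Qed.

Lemma exists_common_neighbour_family : exists N, forall n (p : 'I_n -> point),
  N <= n -> general_position p ->
  exists w : 'I_5 -> seg_vertex n, forall x y,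
    exists a, disjointness_graph p x (w a) /\ disjointness_graph p y (w a).
Proof.
have [N HN] := ramsey 3 10; exists N => n p Nn gp.
pose c (t : seq 'I_n) := if t is [:: i; j; k]
  then `[< oriented R1 (p i) (p j) (p k) >] else false.
have [|t [b [ts t10 ht]]] := HN _ c (enum 'I_n); first by rewrite size_enum_ord.
have ut : uniq t by apply: subseq_uniq ts (enum_uniq _).
have [i0 _] : exists i0, i0 \in t.
  by case: t t10 {ts ht ut} => // i0 t _; exists i0; apply: mem_head.
pose q := nth i0 t.
have q_inj u v : u < 10 -> v < 10 -> u != v -> q u != q v.
  by move=> u10 v10 uv; rewrite /q nth_uniq // (leq_trans _ t10).
(* Consecutive points are paired, so [q u] is an endpoint of the segment numbered [u./2]. *)
have w_sig (a : 'I_5) : {x : seg_vertex n | val x = [set q a.*2; q a.*2.+1]}.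
  apply: seg_vertex_pair; apply: q_inj; rewrite ?neq_ltn ?ltnSn //.
    by case: a => -[|[|[|[|[|]]]]].
  by case: a => -[|[|[|[|[|]]]]].
pose w a := sval (w_sig a).
have wP a i : i \in val (w a) -> exists u, [/\ i = q u, u < 10 & u./2 = a].
  rewrite (svalP (w_sig a)) !inE => /orP[] /eqP ->.
    by exists a.*2; rewrite doubleK; split=> //; case: a => -[|[|[|[|[|]]]]].
  by exists a.*2.+1; rewrite /= uphalf_double; split=> //; case: a => -[|[|[|[|[|]]]]].
have half_lt u v : u./2 < v./2 -> u < v.
  by rewrite !ltnNge; apply: contra => /half_leq.
(* Colour [false] only excludes a positive orientation; general position excludes zero, leaving the
   sign -1. *)
pose s := if b then R1 else Ropp R1.
have hw (a a' a'' : 'I_5) i j k : a < a' < a'' ->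
    i \in val (w a) -> j \in val (w a') -> k \in val (w a'') ->
    oriented s (p i) (p j) (p k).
  move=> lt_a /wP[u [-> u10 ua]] /wP[v [-> v10 va]] /wP[r [-> r10 ra]].
  move: lt_a; rewrite -ua -va -ra => /andP[/half_lt uv /half_lt vr].
  have := ht _ (@subseq_nth3 _ i0 t u v r _ _) erefl.
  rewrite uv vr (leq_trans r10) // => /(_ isT isT); rewrite /c -/(q u) -/(q v) -/(q r).
  rewrite /s /oriented; case: (b) => /asboolP; first by lra.
  have /gp : q u != q v by apply: q_inj; rewrite // neq_ltn uv.
  have qvr : q v != q r by apply: q_inj; rewrite // neq_ltn vr.
  have qur : q u != q r by apply: q_inj; rewrite // neq_ltn (ltn_trans uv vr).
  move=> /(_ _ qvr qur).
  by rewrite /collinear -/(orient (p (q u)) (p (q v)) (p (q r))); lra.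
exists w => x y.
pose M z := [set a | ~~ `[< disjointness_graph p z (w a) >]].
have M2 z : #|M z| <= 2 by apply: seg_meets_at_most_two hw.
(* The segments [x] and [y] together meet at most 2 + 2 < 5 of the family. *)
have /subsetPn[a _] : ~~ ([set: 'I_5] \subset M x :|: M y).
  apply/negP => /subset_leq_card; rewrite cardsT card_ord leqNgt ltnS.
  by rewrite (leq_trans (leq_card_setU _ _)) // (leq_add (M2 x) (M2 y)).
rewrite !inE negb_or !negbK => /andP[/asboolP xa /asboolP ya].
by exists a.
Qed.

(** * Two segments that block three given ones *)

(** A cherry is a path with two edges, here [[set a; b]] and [[set a; c]] with centre [a]. *)
Definition hitting_cherry (T : finType) (ws : seq {set T}) (a b c : T) : Prop :=
  [/\ a != b, a != c & b != c] /\
  forall w, w \in ws ->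
    [/\ w != [set a; b], w != [set a; c] & [|| a \in w, b \in w | c \in w]].

(** If two of the three segments share an endpoint [v], one takes [v], an endpoint
of the third segment, and a centre away from all three segments. *)
Lemma exists_hitting_cherry n (w1 w2 w3 : {set 'I_n}) : 6 < n ->
  #|w1| = 2 -> #|w2| = 2 -> #|w3| = 2 ->
  exists a b c, hitting_cherry [:: w1; w2; w3] a b c.
Proof.
move=> n7 s1 s2 s3.
have [c0 c0w] : exists c0, forall w, w \in [:: w1; w2; w3] -> c0 \notin w.
  have /subsetPn[c0 _] : ~~ ([set: 'I_n] \subset w1 :|: w2 :|: w3).
    apply/negP => /subset_leq_card; rewrite cardsT card_ord leqNgt => /negP; apply.
    apply: leq_ltn_trans n7; apply: leq_trans (leq_card_setU _ _) _.
    by rewrite s3 (leq_add (n1 := 4)) // (leq_trans (leq_card_setU _ _)) // s1 s2.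
  rewrite !inE !negb_or -andbA => /and3P[c1 c2 c3].
  by exists c0 => w; rewrite !inE => /or3P[] /eqP->.
(* Stating this up to reordering covers all three choices of the pair that shares [v]. *)
have shared u1 u2 u3 v : [:: u1; u2; u3] =i [:: w1; w2; w3] ->
    v \in u1 -> v \in u2 -> #|u3| = 2 ->
    exists a b c, hitting_cherry [:: w1; w2; w3] a b c.
  move=> uw v1 v2 u3s.
  have /set0Pn[r] : u3 :\ v != set0.
    by rewrite -card_gt0 -ltnS; move: u3s; rewrite (cardsD1 v) => <-; case: (v \in u3).
  rewrite !inE => /andP[rv r3]; exists c0, v, r; split.
    split; last by rewrite eq_sym.
      by apply: contraTneq v1 => <-; rewrite c0w // -uw mem_head.
    by apply: contraTneq r3 => <-; rewrite c0w // -uw !inE eqxx !orbT.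
  move=> w ww; split.
  - by apply: contraNneq (c0w w ww) => ->; rewrite !inE eqxx.
  - by apply: contraNneq (c0w w ww) => ->; rewrite !inE eqxx.
  by move: ww; rewrite -uw !inE => /or3P[] /eqP->; rewrite ?v1 ?v2 ?r3 ?orbT.
have [/set0Pn[v]|] := boolP (w1 :&: w2 != set0).
  by rewrite inE => /andP[v1 v2]; apply: (shared w1 w2 w3 v).
rewrite negbK => /eqP d12.
have [/set0Pn[v]|] := boolP (w1 :&: w3 != set0).
  rewrite inE => /andP[v1 v2]; apply: (shared w1 w3 w2 v) => // w.
  by rewrite !inE [(w == w3) || _]orbC.
rewrite negbK => /eqP d13.
have [/set0Pn[v]|] := boolP (w2 :&: w3 != set0).
  rewrite inE => /andP[v1 v2]; apply: (shared w2 w3 w1 v) => // w.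
  by rewrite !inE [RHS]orbC orbA.
rewrite negbK => /eqP d23.
have nd (A B : {set 'I_n}) i : A :&: B = set0 -> i \in A -> i \notin B.
  by move=> /setP/(_ i); rewrite !inE => + iA; rewrite iA /= => ->.
have [[a a1] [b b2] [c c3]] : [/\ exists a, a \in w1, exists b, b \in w2 & exists c, c \in w3].
  by split; apply/set0Pn; rewrite -card_gt0 ?s1 ?s2 ?s3.
have a2 := nd _ _ _ d12 a1; have a3 := nd _ _ _ d13 a1; have b3 := nd _ _ _ d23 b2.
rewrite setIC in d12; rewrite setIC in d13; rewrite setIC in d23.
have b1 := nd _ _ _ d12 b2; have c1 := nd _ _ _ d13 c3; have c2 := nd _ _ _ d23 c3.
(* The three segments now have no common endpoints, so each contains exactly one of [a], [b], [c]
   and is not an edge of the cherry. *)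
exists a, b, c; split.
  by split; [apply: contraNneq b1 => <-|apply: contraNneq c1 => <-|apply: contraNneq c2 => <-].
have neq (A : {set 'I_n}) i j : (i \notin A) || (j \notin A) -> A != [set i; j].
  by apply: contraTneq => ->; rewrite !inE !eqxx orbT.
by move=> w; rewrite !inE => /or3P[] /eqP->;
  split; rewrite ?neq ?a1 ?a2 ?a3 ?b1 ?b2 ?b3 ?c1 ?c2 ?c3 ?orbT.
Qed.

Lemma card_seg_vertex n : #|{: seg_vertex n}| = 'C(n, 2).
Proof.
rewrite card_sig -[in RHS](card_ord n) -card_draws.
by apply: eq_card => A; rewrite !inE.
Qed.

(** * Visibility at distance at most two *)

Section MutualVisibility.
Variables (V : finType) (e : V -> V -> Prop).
Implicit Types (U : {set V}) (x y w : V).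

Lemma mutually_visible_adjacent U x y : x != y -> e x y -> mutually_visible e U x y.
Proof.
move=> xy exy; exists [:: y]; split=> //; do !split=> //.
by case=> //= _ xy'; rewrite xy' eqxx in xy.
Qed.

Lemma mutually_visible_common_neighbour U x y w :
  x != y -> e x w -> e w y -> w \notin U -> mutually_visible e U x y.
Proof.
move=> xy exw ewy wU; have [exy|nexy] := pselect (e x y).
  exact: mutually_visible_adjacent.
exists [:: w; y]; split; last by move=> v; rewrite /= inE => /eqP->.
do !split=> //; case=> [_ /= xy'|z [[exz _] /= zy|//]]; first by rewrite xy' eqxx in xy.
by rewrite zy in exz.
Qed.

(** The distance is exactly two, so a shortest path has a single internal vertex. *)
Lemma mutually_visible_distance2 U x y w :
  x != y -> ~ e x y -> e x w -> e w y -> mutually_visible e U x y ->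
  exists2 v, v \notin U & e x v /\ e v y.
Proof.
move=> xy nexy exw ewy [s [[ws [ls smin]] sU]].
have {smin} := smin [:: w; y] (conj exw (conj ewy I)) erefl.
case: s ws ls sU => [_ /= xy'|v [[exv _] /= vy|y' [|//]]].
- by rewrite xy' eqxx in xy.
- by rewrite vy in exv.
move=> [exv [evy _]] /= y'y sU _; exists v; last by rewrite -y'y.
by apply: sU; rewrite inE.
Qed.

Lemma mu_geq U : mutual_visibility_set e U -> #|U| <= mu e.
Proof. by move=> hU; apply: (@leq_bigmax_cond _ _ (fun U : {set V} => #|U|)); apply/asboolP. Qed.

Lemma mu_leq m : (forall U, mutual_visibility_set e U -> #|U| <= m) -> mu e <= m.
Proof. by move=> h; apply/bigmax_leqP => U /asboolP/h. Qed.

End MutualVisibility.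

(** * The two bounds *)

Lemma mutual_visibility_set_compl_card n (p : 'I_n -> point) (U : {set seg_vertex n}) :
  6 < n ->
  (forall x y, exists w, disjointness_graph p x w /\ disjointness_graph p y w) ->
  mutual_visibility_set (disjointness_graph p) U -> 3 < #|~: U|.
Proof.
move=> n7 common visU; rewrite ltnNge; apply/negP => U3.
have [w0 _] := seg_vertex_pair (isT : Ordinal (ltnW n7) != Ordinal (ltn_trans (isT : 0 < 6) n7)).
(* If fewer than three vertices lie outside [U], the list is padded with the arbitrary segment
   [w0]. *)
pose w k := val (nth w0 (enum (~: U)) k).
have wP v : v \notin U -> val v \in [:: w 0; w 1; w 2].
  rewrite -in_setC -mem_enum => vU.
  have := index_mem v (enum (~: U)); rewrite vU -cardE => /leq_trans/(_ U3) i3.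
  rewrite -[v](nth_index w0 vU) -/(w _).
  by move: (index _ _) i3 => [|[|[|]]] //; rewrite !inE eqxx ?orbT.
have w2 k : #|w k| = 2 by apply/eqP; exact: (valP (nth w0 _ k)).
have [a [b [c [[ab ac bc] hit]]]] := exists_hitting_cherry n7 (w2 0) (w2 1) (w2 2).
have [x vx] := seg_vertex_pair ab; have [y vy] := seg_vertex_pair ac.
have xU : x \in U.
  by apply/negPn/negP => /wP/hit[]; rewrite vx eqxx.
have yU : y \in U.
  by apply/negPn/negP => /wP/hit[]; rewrite vy eqxx.
have xy : x != y.
  apply: contraNneq bc => xy; have : b \in val y by rewrite -xy vx !inE eqxx orbT.
  by rewrite vy !inE eq_sym (negPf ab).
have [ax bx] : a \in val x /\ b \in val x by rewrite vx !inE !eqxx orbT.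
have [ay cy] : a \in val y /\ c \in val y by rewrite vy !inE !eqxx orbT.
(* The vertex [v] puts [x] and [y] at distance two; visibility then yields a common neighbour
   outside [U], but each segment there contains [a], [b] or [c]. *)
have [v [xv yv]] := common x y.
have [u uU [xu uy]] := mutually_visible_distance2 xy
  (common_endpoint_not_adjacent ax ay) xv (disjointness_graph_sym yv) (visU x y xU yU xy).
have [_ _ /or3P[au|bu|cu]] := hit _ (wP u uU).
- exact: common_endpoint_not_adjacent ax au xu.
- exact: common_endpoint_not_adjacent bx bu xu.
- exact: common_endpoint_not_adjacent cu cy uy.
Qed.

Theorem theorem4 :
  exists N : nat, forall (n : nat) (p : 'I_n -> point),
    N <= n -> injective p -> general_position p ->
    'C(n, 2) <= mu (disjointness_graph p) + 5 /\
    mu (disjointness_graph p) + 4 <= 'C(n, 2).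
Proof.
have [N HN] := exists_common_neighbour_family.
exists (maxn N 7) => n p; rewrite geq_max => /andP[Nn n7] _ gp.
have [w hw] := HN n p Nn gp.
rewrite -card_seg_vertex; split.
  pose U := ~: [set w a | a : 'I_5].
  have visU : mutual_visibility_set (disjointness_graph p) U.
    move=> x y _ _ xy; have [a [xa ya]] := hw x y.
    apply: mutually_visible_common_neighbour xy xa (disjointness_graph_sym ya) _.
    by rewrite inE negbK imset_f.
  rewrite -(cardsC U) leq_add ?mu_geq // setCK.
  by rewrite (leq_trans (leq_imset_card _ _)) // card_ord.
(* This makes the truncated subtraction of 4 below exact. *)
have C4 : 4 <= #|{: seg_vertex n}|.
  by rewrite card_seg_vertex (leq_trans _ (leq_bin2l 2 n7)).
rewrite addnC -leq_subRL //; apply: mu_leq => U visU.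
rewrite leq_subRL // addnC -(cardsC U) leq_add2l.
apply: mutual_visibility_set_compl_card visU => // x y.
by have [a ?] := hw x y; exists (w a).
Qed.
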